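(* Let $n \geq 1$ be an integer with $n \notin \{1, 2, 5\}$. Then the regular complete bipartite graph $K_{n,n}$ is not a geodesic Leech graph.
   Context: All graphs are finite, simple and undirected. A geodesic path in a graph $G$ is a path with at least one edge which is a shortest path in $G$ between its two end vertices; paths are undirected (a path and its reversal are the same path). The geodesic path number $t_{gp}(G)$ is the total number of geodesic paths in $G$. For an edge labeling $f : E(G) \to \{1,2,3,\dots\}$, the weight of a path $P$ is $w(P) = \sum_{e \in E(P)} f(e)$. The labeling $f$ is a geodesic Leech labeling of $G$ if the set of weights of the $t_{gp}(G)$ geodesic paths in $G$ is $\{1,2,\dots,t_{gp}(G)\}$ (so each of these values is the weight of exactly one geodesic path). A graph which admits a geodesic Leech labeling is called a geodesic Leech graph. *)

(* Defs.v *)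
From mathcomp Require Import all_boot.

Set Implicit Arguments.
Unset Strict Implicit.
Unset Printing Implicit Defensive.

Record sgraph := SGraph {
  vertex :> finType;
  adj : rel vertex;
  adj_sym : symmetric adj;
  adj_irrefl : irreflexive adj }.

Definition edges (G : sgraph) : {set {set G}} :=
  [set [set u.1; u.2] | u : G * G & adj u.1 u.2].

(* The path traversed from x through the successive vertices of p; its end
   vertices are x and last x p, and it has size p edges. *)
Definition is_path (G : sgraph) (x : G) (p : seq G) : bool :=
  path (@adj G) x p && uniq (x :: p).

Definition path_edges (G : sgraph) (x : G) (p : seq G) : {set {set G}} :=
  [set [set u.1; u.2] | u in zip (x :: p) p].

(* The quantification over tuples of size n < size p says that no path with the
   same end vertices is shorter; see geodesicP. *)
Definition geodesic (G : sgraph) (x : G) (p : seq G) : bool :=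
  [&& 0 < size p, is_path x p &
      [forall n : 'I_(size p), forall q : n.-tuple G,
         ~~ (is_path x q && (last x q == last x p))]].

(* An undirected path with at least one edge is represented by its edge set,
   which is the same for the path and its reversal and determines the path up
   to reversal. Since a path has fewer than #|G| edges, bounding the length
   loses nothing; see geodesic_pathsP. *)
Definition geodesic_paths (G : sgraph) : {set {set {set G}}} :=
  [set P | [exists n : 'I_#|G|, exists x : G, exists p : n.-tuple G,
              geodesic x p && (P == path_edges x p)]].

Definition geodesic_path_number (G : sgraph) : nat := #|geodesic_paths G|.

Definition weight (G : sgraph) (f : {set G} -> nat) (P : {set {set G}}) : nat :=
  \sum_(e in P) f e.

(* A labeling of E(G) is a function on all vertex sets, of which only the
   values on edges matter. *)
Definition edge_labeling (G : sgraph) (f : {set G} -> nat) : Prop :=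
  {in edges G, forall e, 0 < f e}.

Definition geodesic_leech_labeling (G : sgraph) (f : {set G} -> nat) : Prop :=
  edge_labeling f /\
  forall k : nat,
    (exists2 P, P \in geodesic_paths G & weight f P = k) <->
    1 <= k <= geodesic_path_number G.

Definition geodesic_leech_graph (G : sgraph) : Prop :=
  exists f : {set G} -> nat, geodesic_leech_labeling f.

Definition bipartite_adj (m n : nat) : rel ('I_m + 'I_n) :=
  fun u v => match u, v with
             | inl _, inr _ | inr _, inl _ => true
             | _, _ => false
             end.

Lemma bipartite_adj_sym m n : symmetric (@bipartite_adj m n).
Proof. by case=> ? []. Qed.

Lemma bipartite_adj_irrefl m n : irreflexive (@bipartite_adj m n).
Proof. by case. Qed.

Definition complete_bipartite (m n : nat) : sgraph :=
  SGraph (@bipartite_adj_sym m n) (@bipartite_adj_irrefl m n).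

Lemma geodesicP (G : sgraph) (x : G) (p : seq G) :
  reflect [/\ 0 < size p, is_path x p &
              forall q, is_path x q -> last x q = last x p -> size p <= size q]
          (geodesic x p).
Proof.
apply: (iffP and3P) => -[p_gt0 Pp min_p]; split=> //.
  move=> q Pq eq_last; rewrite leqNgt; apply/negP => lt_qp.
  move/forallP/(_ (Ordinal lt_qp))/forallP/(_ (in_tuple q)): min_p.
  by rewrite Pq eq_last eqxx.
apply/forallP => n; apply/forallP => q; apply/negP => /andP[Pq /eqP eq_last].
by have := min_p q Pq eq_last; rewrite size_tuple leqNgt ltn_ord.
Qed.

Lemma geodesic_pathsP (G : sgraph) (P : {set {set G}}) :
  reflect (exists x p, geodesic x p /\ P = path_edges x p)
          (P \in geodesic_paths G).
Proof.
rewrite inE; apply: (iffP existsP) => [[n /existsP[x /existsP[p]]]|].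
  by case/andP=> gp /eqP ->; exists x, p.
case=> x [p [gp ->]].
have lt_p : size p < #|G|.
  have /geodesicP[_ /andP[_ Up] _] := gp.
  by rewrite -[(size p).+1]/(size (x :: p)) -(card_uniqP Up) max_card.
exists (Ordinal lt_p); apply/existsP; exists x; apply/existsP.
by exists (in_tuple p); rewrite gp eqxx.
Qed.

(* Main.v *)
Require Import Defs.
From mathcomp Require Import all_boot.
From mathcomp Require Import zify.

Set Implicit Arguments.
Unset Strict Implicit.
Unset Printing Implicit Defensive.

(** The geodesic paths of K_{n,n} are its n^2 edges and the pairs of adjacent
    edges, n^3 in all, and each edge lies on 2n - 1 of them. Adding up the
    weights 1, ..., n^3 therefore gives (2n - 1) S = n^3 (n^3 + 1) / 2, where S
    is the sum of the labels. As 2n - 1 is coprime to n it divides n^3 + 1,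
    hence also 8 (n^3 + 1) = ((2n - 1) + 1)^3 + 8, so it divides 9. *)

(** The [N] weights cover the [N] values 1, ..., [N], so by pigeonhole each value is attained
    exactly once, and the weights add up to a triangular number. *)
Lemma sum_weight_leech (G : sgraph) (f : {set G} -> nat) :
  geodesic_leech_labeling f ->
  (\sum_(P in geodesic_paths G) weight f P).*2
    = geodesic_path_number G * (geodesic_path_number G).+1.
Proof.
case=> _ leech_f; set N := geodesic_path_number G.
pose s := [seq weight f P | P <- enum (geodesic_paths G)].
have size_s : size s = N by rewrite size_map -cardE.
have sub_s : {subset iota 1 N <= s}.
  move=> k; rewrite mem_iota add1n ltnS => /leech_f[P gP <-].
  by apply: map_f; rewrite mem_enum.
have le_s : size s <= size (iota 1 N) by rewrite size_s size_iota.
have perm_s : perm_eq (iota 1 N) s.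
  have [_ eq_s] := uniq_min_size (iota_uniq 1 N) sub_s le_s.
  apply: uniq_perm eq_s; first exact: iota_uniq.
  exact: leq_size_uniq (iota_uniq 1 N) sub_s le_s.
rewrite -big_enum /= -(big_map (weight f) predT id) -(perm_big _ perm_s) /=.
have -> : iota 1 N = index_iota 1 N.+1 by rewrite /index_iota subSS subn0.
elim: N {s size_s sub_s le_s perm_s leech_f} => [|N IHN]; first by rewrite big_geq.
by rewrite big_nat_recr //= doubleD IHN; lia.
Qed.

Lemma path_edges1 (G : sgraph) (x y : G) :
  path_edges x [:: y] = [set [set x; y]].
Proof.
apply/setP => e; rewrite inE; apply/imsetP/eqP => [[u]|->].
  by rewrite inE => /eqP ->.
by exists (x, y); rewrite ?inE.
Qed.

Lemma path_edges2 (G : sgraph) (x y z : G) :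
  path_edges x [:: y; z] = [set [set x; y]; [set y; z]].
Proof.
apply/setP => e; rewrite !inE; apply/imsetP/orP => [[u]|].
  by rewrite !inE => /orP[] /eqP -> ->; [left | right].
by case=> /eqP ->; [exists (x, y) | exists (y, z)]; rewrite ?inE ?eqxx ?orbT.
Qed.

(** * Sums over ordered pairs of indices *)

Section SumPairs.

Variables (n : nat) (b : 'I_n -> nat).

(** Exchanging the indices in the second term, [b j] is counted once for each [k >= j] and once for
    each [k < j]. The factor [(j < k)] keeps a single edge, [j = k], from being counted twice. *)
Lemma sum_le_pairs :
  \sum_(j < n) \sum_(k < n | j <= k) (b j + (j < k) * b k) = n * \sum_j b j.
Proof.
transitivity (\sum_(j < n) (\sum_(k < n) (j <= k) * b j + \sum_(k < n) (j < k) * b k)).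
  apply: eq_bigr => j _; rewrite -big_split big_mkcond; apply: eq_bigr => k _.
  by case: ltngtP => _; rewrite /= ?mul1n.
rewrite big_split /= [X in _ + X]exchange_big -big_split big_distrr /=.
apply: eq_bigr => j _; rewrite -big_split /=.
under eq_bigr => k _ do rewrite -mulnDl leqNgt addn_negb mul1n.
by rewrite sum_nat_const card_ord.
Qed.

(** By symmetry this differs from the previous sum only in the diagonal [j = k], which contributes
    [\sum_j b j]. *)
Lemma sum_gt_pairs :
  \sum_(j < n) \sum_(k < n | k < j) (b j + b k) + \sum_j b j = n * \sum_j b j.
Proof.
rewrite -sum_le_pairs.
rewrite (eq_bigr _ (fun j _ => big_mkcond _ _)).
rewrite exchange_big -big_split /=; apply: eq_bigr => j _.
rewrite [RHS](bigD1 j) //= ltnn addn0 addnC; congr (_ + _).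
rewrite -big_mkcond; apply: eq_big => [k|k lt_jk]; first by rewrite ltn_neqAle andbC eq_sym.
by rewrite lt_jk mul1n addnC.
Qed.

End SumPairs.

(** * Geodesic paths of the complete bipartite graph, indexed by triples *)

Section CompleteBipartite.

Variable n : nat.

Let K := complete_bipartite n n.

Definition bip_edge (u : 'I_n * 'I_n) : {set K} := [set inl u.1; inr u.2].

Lemma bip_edge_inj : injective bip_edge.
Proof.
move=> [i j] [i' j'] /setP eq_e; congr (_, _); apply/eqP.
  by have := eq_e (inl i); rewrite !inE eqxx /= orbF => /esym.
by have := eq_e (inr j); rewrite !inE eqxx /= => /esym.
Qed.

(* The triples (i, j, k) with j <= k stand for the paths j - i - k centred at i
   on the left (a single edge if j = k), those with k < j for the paths
   j - i - k centred at i on the right, so each path arises exactly once. *)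
Definition path_ends (t : 'I_n * 'I_n * 'I_n) :=
  let: (i, j, k) := t in
  if j <= k then ((i, j), (i, k)) else ((j, i), (k, i)).

Definition triple_path (t : 'I_n * 'I_n * 'I_n) : {set {set K}} :=
  [set bip_edge (path_ends t).1; bip_edge (path_ends t).2].

Lemma triple_path_inj : injective triple_path.
Proof.
have in_path t u : bip_edge u \in triple_path t =
    (u == (path_ends t).1) || (u == (path_ends t).2).
  by rewrite !inE !(inj_eq bip_edge_inj).
(* Testing membership at the four ends suffices. A left-centred and a right-centred path never
   agree: the ends of the former share their left vertex, those of the latter have distinct ones. *)
move=> t t' /setP eq_tt'; have {eq_tt'} eq_u u := eq_tt' (bip_edge u).
have := (eq_u (path_ends t).1, eq_u (path_ends t).2).
have := (eq_u (path_ends t').1, eq_u (path_ends t').2).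
rewrite !in_path !eqxx !orbT => -[/= + +] [/= + +].
case: t t' {in_path eq_u} => [[i j] k] [[i' j'] k'] /=.
case: leqP => ?; case: leqP => ? /=; rewrite !xpair_eqE -!val_eqE /= => *;
  suff [-> -> ->] : [/\ i = i', j = j' & k = k'] by [];
  split; apply: val_inj => /=; lia.
Qed.

Lemma adjacent_edges_path u v :
  (u.1 == v.1) || (u.2 == v.2) ->
  [set bip_edge u; bip_edge v] \in codom triple_path.
Proof.
case: u v => [i j] [i' j'] /= /orP[] /eqP <-{}.
- case: (leqP j j') => jj'; apply/codomP.
    by exists (i, j, j'); rewrite /triple_path /= jj'.
  by exists (i, j', j); rewrite /triple_path /= (ltnW jj') setUC.
- case: (ltngtP i i') => [ii'|ii'|/val_inj <-]; apply/codomP.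
  + by exists (j, i', i); rewrite /triple_path /= leqNgt ii' setUC.
  + by exists (j, i, i'); rewrite /triple_path /= leqNgt ii'.
  (* Right-centred triples need distinct ends, so a single edge is always coded as left-centred. *)
  + by exists (i, j, j); rewrite /triple_path /= leqnn.
Qed.

(** If the ends are adjacent, one edge joins them. Otherwise they lie on the same side, so the
    second vertex [y] of the path is a common neighbour. *)
Lemma geodesic_size_le2 (x : K) p : geodesic x p -> size p <= 2.
Proof.
case/geodesicP; case: p => [|y p] // _ /andP[/andP[xy _]].
rewrite -[uniq _]/((x \notin y :: p) && _) => /andP[x_p _] min_p.
have last_p : last x (y :: p) \in y :: p := mem_last y p.
have x_last : x != last x (y :: p) by apply: contraNneq x_p => {1}->.
move: (last x _) x_last min_p {last_p x_p} => z x_z min_p.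
have [xz|xz] := boolP (adj x z).
  apply: leq_trans (min_p [:: z] _ _) _ => //.
  by rewrite /is_path /= !andbT !inE x_z andbT.
apply: (min_p [:: y; z]) => //; rewrite /is_path /= !inE.
by case: x y z xy x_z xz {min_p} => [i|i] [j|j] [k|k] //= _ ->.
Qed.

Lemma geodesic_triple_path (t : 'I_n * 'I_n * 'I_n) :
  triple_path t \in geodesic_paths K.
Proof.
(* Distinct non-adjacent ends are at distance at least 2, so a two-edge path between them is
   shortest. *)
have path2 (x y z : K) : adj x y -> adj y z -> x != z -> ~~ adj x z ->
    [set [set x; y]; [set y; z]] \in geodesic_paths K.
  move=> xy yz x_z xz; apply/geodesic_pathsP.
  exists x, [:: y; z]; rewrite path_edges2; split=> //; apply/geodesicP; split=> //.
    rewrite /is_path /= !inE; move: xy yz x_z.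
    by case: x y z {xz} => [i|i] [j|j] [k|k] //= _ _ ->.
  case=> [|u [|v q]] //=; first by move=> _ eq_xz; rewrite eq_xz eqxx in x_z.
  by rewrite /is_path /= => /andP[/andP[xu _] _] eq_uz; case/negP: xz; rewrite -eq_uz.
case: t => [[i j] k]; rewrite /triple_path /=.
have inj_inl : injective (@inl 'I_n 'I_n) by move=> ? ? [].
have inj_inr : injective (@inr 'I_n 'I_n) by move=> ? ? [].
case: (ltngtP j k) => [lt_jk|lt_kj|/val_inj <-] /=.
- rewrite /bip_edge /= [X in [set X; _]]setUC; apply: path2 => //=.
  by rewrite (inj_eq inj_inr) -val_eqE /= neq_ltn lt_jk.
- rewrite /bip_edge /= [X in [set _; X]]setUC; apply: path2 => //=.
  by rewrite (inj_eq inj_inl) -val_eqE /= neq_ltn lt_kj orbT.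
- rewrite setUid; apply/(@geodesic_pathsP K).
  exists (inl i : K), [:: inr j : K]; rewrite path_edges1; split=> //.
  by apply/geodesicP; split=> //; case.
Qed.

Lemma geodesic_paths_bipartite : geodesic_paths K =i codom triple_path.
Proof.
move=> P; apply/idP/codomP => [/geodesic_pathsP[x [p [gp ->]]]|[t ->]]; last first.
  exact: geodesic_triple_path.
apply/codomP; have := geodesic_size_le2 gp; have /geodesicP[] := gp.
case: p {gp} => [|y [|z []]] // _ /andP[/= p_path _] _ _.
  (* A single edge is treated as a pair of equal edges. *)
  rewrite path_edges1 -[X in X \in _]setUid; move: p_path.
  case: x y => [i|i] [j|j] //= _; last rewrite [X in [set X]]setUC.
    by apply: (@adjacent_edges_path (i, j) (i, j)); rewrite eqxx.
  by apply: (@adjacent_edges_path (j, i) (j, i)); rewrite eqxx.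
rewrite path_edges2; move: p_path; case: x y z => [i|i] [j|j] [k|k] //= _.
  rewrite [X in [set _; X]]setUC.
  by apply: (@adjacent_edges_path (i, j) (k, j)); rewrite eqxx orbT.
rewrite [X in [set X; _]]setUC.
by apply: (@adjacent_edges_path (j, i) (j, k)); rewrite eqxx.
Qed.

(** * The number and the total weight of the geodesic paths *)

Lemma sum_geodesic_paths (F : {set {set K}} -> nat) :
  \sum_(P in geodesic_paths K) F P = \sum_t F (triple_path t).
Proof.
rewrite (eq_bigl _ _ geodesic_paths_bipartite).
rewrite -big_uniq; last by rewrite map_inj_uniq ?enum_uniq //; apply: triple_path_inj.
by rewrite big_map big_enum.
Qed.

Lemma geodesic_path_number_bipartite : geodesic_path_number K = n ^ 3.
Proof.
rewrite /geodesic_path_number -sum1_card sum_geodesic_paths sum1_card.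
by rewrite !card_prod card_ord -mulnA.
Qed.

(** Left-centred paths contribute [n * S], right-centred ones [n * S - S]; moving [S] to the left
    avoids subtraction in [nat]. *)
Lemma sum_weight_bipartite (f : {set K} -> nat) :
  let S := \sum_i \sum_j f (bip_edge (i, j)) in
  \sum_(P in geodesic_paths K) weight f P + S = (n * S).*2.
Proof.
set a := fun i j => f (bip_edge (i, j)); move=> S.
have S_tr : S = \sum_j \sum_i a i j by rewrite /S exchange_big.
have weight_triple i j k : weight f (triple_path (i, j, k)) =
    if j <= k then a i j + (j < k) * a i k else a j i + a k i.
  rewrite /weight /triple_path /=; case: (ltngtP j k) => [lt_jk|lt_kj|/val_inj <-] /=.
  - rewrite big_setU1 ?big_set1 ?mul1n // inE (inj_eq bip_edge_inj).
    by rewrite xpair_eqE eqxx -val_eqE /= neq_ltn lt_jk.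
  - rewrite big_setU1 ?big_set1 // inE (inj_eq bip_edge_inj).
    by rewrite xpair_eqE eqxx andbT -val_eqE /= neq_ltn lt_kj orbT.
  - by rewrite setUid big_set1 addn0.
have -> : \sum_(P in geodesic_paths K) weight f P =
    \sum_(i < n) \sum_(j < n) \sum_(k < n | j <= k) (a i j + (j < k) * a i k)
    + \sum_(i < n) \sum_(j < n) \sum_(k < n | k < j) (a j i + a k i).
  rewrite sum_geodesic_paths.
  transitivity (\sum_i \sum_j \sum_k weight f (triple_path (i, j, k))).
    by rewrite !pair_bigA; apply: eq_bigr => -[[i j] k].
  rewrite -big_split; apply: eq_bigr => i _; rewrite -big_split.
  apply: eq_bigr => j _; rewrite (bigID (fun k : 'I_n => j <= k)) /=.
  congr (_ + _); apply: eq_big => k; rewrite ?weight_triple -?ltnNge //.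
    by move->.
  by case: leqP.
under eq_bigr => j _ do rewrite sum_le_pairs.
rewrite -big_distrr /= -addnA -addnn; congr (_ + _).
(* Right-centred paths fix the right vertex, so [S] is now summed over right vertices first. *)
rewrite {1 2}S_tr -big_split /=.
by under eq_bigr => j _ do rewrite sum_gt_pairs; rewrite -big_distrr.
Qed.

End CompleteBipartite.

Theorem theorem2p7 (n : nat) (n_ge1 : 1 <= n) (n_notin : n \notin [:: 1; 2; 5]) :
  ~ geodesic_leech_graph (complete_bipartite n n).
Proof.
case=> f /sum_weight_leech; rewrite geodesic_path_number_bipartite.
have := sum_weight_bipartite f; set S := \sum_i _; set W := \sum_(P in _) _.
move=> /= W_S W_n; set d := n.*2.-1.
have dn : n.*2 = d.+1 by rewrite /d; lia.
have dvd_d : d %| n ^ 3 * (n ^ 3).+1.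
  apply/dvdnP; exists S.*2; rewrite -W_n.
  have : n.*2 * S.*2 = d * S.*2 + S.*2 by rewrite dn mulSn addnC.
  lia.
(* [n] divides [n.*2], the successor of [d]. *)
have co_dn : coprime d n.
  by apply: (@coprime_dvdr n n.*2); [rewrite -mul2n dvdn_mull | rewrite dn coprimenS].
rewrite Gauss_dvdr ?coprimeXr // in dvd_d.
have /dvdnP[q eq9] : d %| 9.
  have : d %| 8 * (n ^ 3).+1 by rewrite dvdn_mull.
  have -> : 8 * (n ^ 3).+1 = d * (d ^ 2 + 3 * d + 3) + 9.
    have : n.*2 ^ 3 = d.+1 ^ 3 by rewrite dn.
    rewrite -mul2n !expnS !expn0; lia.
  by rewrite dvdn_addr ?dvdn_mulr.
(* The divisors 1, 3, 9 of 9 give [n] = 1, 2, 5, exactly the excluded values. *)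
have : d \in divisors 9 by rewrite -dvdn_divisors // eq9 dvdn_mull.
by move: n_notin; rewrite !inE; lia.
Qed.
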